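(* Let $(\Phi,\Theta)\in\{(\Gamma,\Gamma),(\Delta,\Delta),(\Delta,\Gamma)\}$. Then the $R^{\Phi}_{\Theta}$-matrix satisfies the Yang–Baxter equation: for all spins $a,b,c,d,e,f\in\mathbf c\sqcup\{0\}$ and all parameters $z_i,z_j$, $$\sum_{p,q,r}R^{\Phi}_{\Theta}(z_i,z_j)(a,b,p,q)\,L^{\Phi}_{z_i}(p,c,d,r)\,L^{\Theta}_{z_j}(q,r,e,f)=\sum_{p,q,r}L^{\Theta}_{z_j}(b,c,p,r)\,L^{\Phi}_{z_i}(a,r,q,f)\,R^{\Phi}_{\Theta}(z_i,z_j)(q,p,d,e),$$ where $p,q,r$ range over $\mathbf c\sqcup\{0\}$.
   Context: $\mathbf c$ is a totally ordered set of $2n$ colors; a spin is an element of $\mathbf c\sqcup\{0\}$. Below $x>y$ denote any two colors with $x$ larger than $y$, and $g$ denotes any color. All unlisted weights are $0$. **$L$-matrices.** $L^{\Gamma}_z$ and $L^{\Delta}_z$ are functions of (left, top, right, bottom) spins at a vertex with parameter $z$. $L^\Gamma_z$: $(0,0,0,0)\mapsto1$; $(y,x,x,y)\mapsto z$; $(x,y,x,y)\mapsto z$; $(g,g,g,g)\mapsto z$; $(g,0,g,0)\mapsto z$; $(0,g,g,0)\mapsto1$; $(g,0,0,g)\mapsto z$. $L^\Delta_z$: $(0,0,0,0)\mapsto z$; $(y,y,x,x)\mapsto1$; $(y,x,y,x)\mapsto1$; $(g,g,g,g)\mapsto1$; $(g,0,g,0)\mapsto1$; $(g,g,0,0)\mapsto1$;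 $(0,0,g,g)\mapsto z$. **$R$-matrices.** $R^\Phi_\Theta(z_i,z_j)$ is a function of (bottom-left, top-left, top-right, bottom-right) spins at a crossing. $R^\Gamma_\Gamma(z_i,z_j)$: $(0,0,0,0)\mapsto z_j$; $(0,g,g,0)\mapsto z_j$; $(g,0,g,0)\mapsto z_i-z_j$; $(g,0,0,g)\mapsto z_i$; $(y,x,x,y)\mapsto z_i$; $(x,y,y,x)\mapsto z_j$; $(x,y,x,y)\mapsto z_i-z_j$; $(g,g,g,g)\mapsto z_i$. $R^\Delta_\Delta(z_i,z_j)$: $(0,0,0,0)\mapsto z_j$; $(0,g,g,0)\mapsto z_i$; $(0,g,0,g)\mapsto z_i-z_j$; $(g,0,0,g)\mapsto z_j$; $(y,x,x,y)\mapsto z_j$; $(x,y,y,x)\mapsto z_i$; $(x,y,x,y)\mapsto z_i-z_j$; $(g,g,g,g)\mapsto z_i$. $R^\Delta_\Gamma(z_i,z_j)$: $(0,0,0,0)\mapsto z_i-z_j$; $(0,0,g,g)\mapsto z_i$; $(g,0,g,0)\mapsto z_j$; $(0,g,0,g)\mapsto z_j$; $(g,g,0,0)\mapsto z_j$; $(y,y,x,x)\mapsto z_j$; $(y,x,y,x)\mapsto z_j$; $(g,g,g,g)\mapsto z_j$. *)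

(* Defs.v *)
From HB Require Import structures.
From mathcomp Require Import all_boot all_order all_algebra.

Set Implicit Arguments.
Unset Strict Implicit.
Unset Printing Implicit Defensive.

Import Order.TTheory GRing.Theory.
Local Open Scope ring_scope.

(* A spin is a color of C, or the spin 0, encoded as None. *)
Notation spin C := (option C).

Inductive ice := Gamma | Delta.

(* In each weight table below, the comment on a line gives the corresponding
   row: x and y are colors with y < x, g is any color, and 0 is the spin 0. *)

Section Weights.

Variables (d : Order.disp_t) (C : finOrderType d) (R : comNzRingType).
Implicit Types z zi zj : R.

(* The arguments of an L-matrix are the left, top, right and bottom spins. *)

Definition L_Gamma z (l t r b : spin C) : R :=
  match l, t, r, b with
  | None, None, None, None => 1
  | Some l, Some t, Some r, Some b =>
      if [&& l == b, t == r & (l < t)%O] then z               (* (y,x,x,y) *)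
      else if [&& l == r, t == b & (t < l)%O] then z          (* (x,y,x,y) *)
      else if [&& l == t, t == r & r == b] then z             (* (g,g,g,g) *)
      else 0
  | Some l, None, Some r, None => if l == r then z else 0     (* (g,0,g,0) *)
  | None, Some t, Some r, None => if t == r then 1 else 0     (* (0,g,g,0) *)
  | Some l, None, None, Some b => if l == b then z else 0     (* (g,0,0,g) *)
  | _, _, _, _ => 0
  end.

Definition L_Delta z (l t r b : spin C) : R :=
  match l, t, r, b with
  | None, None, None, None => z
  | Some l, Some t, Some r, Some b =>
      if [&& l == t, r == b & (l < r)%O] then 1               (* (y,y,x,x) *)
      else if [&& l == r, t == b & (l < t)%O] then 1          (* (y,x,y,x) *)
      else if [&& l == t, t == r & r == b] then 1             (* (g,g,g,g) *)
      else 0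
  | Some l, None, Some r, None => if l == r then 1 else 0     (* (g,0,g,0) *)
  | Some l, Some t, None, None => if l == t then 1 else 0     (* (g,g,0,0) *)
  | None, None, Some r, Some b => if r == b then z else 0     (* (0,0,g,g) *)
  | _, _, _, _ => 0
  end.

Definition Lmat (Phi : ice) : R -> spin C -> spin C -> spin C -> spin C -> R :=
  match Phi with Gamma => L_Gamma | Delta => L_Delta end.

(* The arguments of an R-matrix are the bottom-left, top-left, top-right and
   bottom-right spins, in this order. *)

Definition R_Gamma_Gamma zi zj (bl tl tr br : spin C) : R :=
  match bl, tl, tr, br with
  | None, None, None, None => zj
  | None, Some tl, Some tr, None => if tl == tr then zj else 0       (* (0,g,g,0) *)
  | Some bl, None, Some tr, None => if bl == tr then zi - zj else 0  (* (g,0,g,0) *)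
  | Some bl, None, None, Some br => if bl == br then zi else 0       (* (g,0,0,g) *)
  | Some bl, Some tl, Some tr, Some br =>
      if [&& bl == br, tl == tr & (bl < tl)%O] then zi               (* (y,x,x,y) *)
      else if [&& bl == br, tl == tr & (tl < bl)%O] then zj          (* (x,y,y,x) *)
      else if [&& bl == tr, tl == br & (tl < bl)%O] then zi - zj     (* (x,y,x,y) *)
      else if [&& bl == tl, tl == tr & tr == br] then zi             (* (g,g,g,g) *)
      else 0
  | _, _, _, _ => 0
  end.

Definition R_Delta_Delta zi zj (bl tl tr br : spin C) : R :=
  match bl, tl, tr, br with
  | None, None, None, None => zj
  | None, Some tl, Some tr, None => if tl == tr then zi else 0       (* (0,g,g,0) *)
  | None, Some tl, None, Some br => if tl == br then zi - zj else 0  (* (0,g,0,g) *)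
  | Some bl, None, None, Some br => if bl == br then zj else 0       (* (g,0,0,g) *)
  | Some bl, Some tl, Some tr, Some br =>
      if [&& bl == br, tl == tr & (bl < tl)%O] then zj               (* (y,x,x,y) *)
      else if [&& bl == br, tl == tr & (tl < bl)%O] then zi          (* (x,y,y,x) *)
      else if [&& bl == tr, tl == br & (tl < bl)%O] then zi - zj     (* (x,y,x,y) *)
      else if [&& bl == tl, tl == tr & tr == br] then zi             (* (g,g,g,g) *)
      else 0
  | _, _, _, _ => 0
  end.

Definition R_Delta_Gamma zi zj (bl tl tr br : spin C) : R :=
  match bl, tl, tr, br with
  | None, None, None, None => zi - zj
  | None, None, Some tr, Some br => if tr == br then zi else 0       (* (0,0,g,g) *)
  | Some bl, None, Some tr, None => if bl == tr then zj else 0       (* (g,0,g,0) *)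
  | None, Some tl, None, Some br => if tl == br then zj else 0       (* (0,g,0,g) *)
  | Some bl, Some tl, None, None => if bl == tl then zj else 0       (* (g,g,0,0) *)
  | Some bl, Some tl, Some tr, Some br =>
      if [&& bl == tl, tr == br & (bl < tr)%O] then zj               (* (y,y,x,x) *)
      else if [&& bl == tr, tl == br & (bl < tl)%O] then zj          (* (y,x,y,x) *)
      else if [&& bl == tl, tl == tr & tr == br] then zj             (* (g,g,g,g) *)
      else 0
  | _, _, _, _ => 0
  end.

(* Rmat Phi Theta is the R-matrix with superscript Phi and subscript Theta.
   There is no such matrix for (Gamma, Delta), where the value is junk. *)
Definition Rmat (Phi Theta : ice) :
    R -> R -> spin C -> spin C -> spin C -> spin C -> R :=
  match Phi, Theta with
  | Gamma, Gamma => R_Gamma_Gamma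
  | Delta, Delta => R_Delta_Delta
  | Delta, Gamma => R_Delta_Gamma
  | Gamma, Delta => fun _ _ _ _ _ _ => 0
  end.

End Weights.

(* Main.v *)
Require Import Defs.
From HB Require Import structures.
From mathcomp Require Import all_boot all_order all_algebra.
From mathcomp Require Import ring.

Set Implicit Arguments.
Unset Strict Implicit.
Unset Printing Implicit Defensive.

Import Order.TTheory GRing.Theory.
Local Open Scope ring_scope.

(** Every L-matrix and every R-matrix conserves spins: two of its four edges
    can be read as incoming and the other two as outgoing, in such a way that
    a nonzero weight forces the outgoing pair of spins to be the incoming pair,
    either carried straight along the two lines or exchanged between them.
    A Gamma-vertex has its left and top edges incoming, a Delta-vertex its left
    and bottom edges, and for Delta-Gamma the Gamma-vertices are
    read backwards.  With these readings, each of the three equations becomes one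
    and the same relation between three lines A, B, C, namely
    [M_AB N_AC K_BC = K_BC N_AC M_AB] ([yang_baxter]); what varies is which
    matrix sits at which crossing.

    Conservation turns the sums over all spins into finite ones: the incoming
    spins u, v, w can only leave in one of their six arrangements, so both
    sides are combinations of eight choices (straight or exchanged at each
    crossing), each contributing to one arrangement
    ([yang_baxter_of_strands]).  The remaining identity involves only u, v, w,
    and the weights depend only on which of them are 0 and on how the colors
    among them compare.  There are finitely many such configurations and in
    each of them the identity is one of polynomials in zi and zj. *)

(** * Spin-conserving vertices on three lines *)

Section ThreeLines.

Variables (T : finType) (R : comNzRingType).
Implicit Types (M N K : T -> T -> T -> T -> R) (u v w : T).

(** In [M u v u' v'] the first line enters with u and leaves with u', the
    second enters with v and leaves with v'. *)
Definition conserves M := forall u v u' v',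
  ~~ ((u' == u) && (v' == v) || (u' == v) && (v' == u)) -> M u v u' v' = 0.

Definition straight M u v := M u v u v.

(** For equal spins the two ways to cross coincide; the weight is then counted
    as [straight] only, so that [vertexE] does not count it twice. *)
Definition exchange M u v := if u == v then 0 else M u v v u.

Lemma vertexE M u v u' v' : conserves M ->
  M u v u' v' = straight M u v * (u' == u)%:R * (v' == v)%:R
              + exchange M u v * (u' == v)%:R * (v' == u)%:R.
Proof.
move=> consM; rewrite /straight /exchange.
have [/orP[]/andP[/eqP-> /eqP->]|other] :=
  boolP ((u' == u) && (v' == v) || (u' == v) && (v' == u)).
- by rewrite !eqxx; case: eqVneq => _ /=; ring.
- by rewrite !eqxx; case: eqVneq => [->|_] /=; ring.
rewrite consM //; move: other.
by case: (u' == u); case: (v' == v); case: (u' == v); case: (v' == u) => //= _;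
  ring.
Qed.

Lemma sum_delta u (F : T -> R) : \sum_p (p == u)%:R * F p = F u.
Proof.
rewrite (bigD1 u) //= eqxx mul1r big1 ?addr0 // => p /negPf->.
by rewrite mul0r.
Qed.

Lemma rotate_sums (F : T -> T -> T -> R) :
  \sum_p \sum_q \sum_r F p q r = \sum_q \sum_r \sum_p F p q r.
Proof. by rewrite exchange_big; apply: eq_bigr => q _; exact: exchange_big. Qed.

Lemma sum_vertex M u v (F : T -> T -> R) : conserves M ->
  \sum_p \sum_q M u v p q * F p q
  = straight M u v * F u v + exchange M u v * F v u.
Proof.
move=> consM.
transitivity (\sum_p ((p == u)%:R * (straight M u v * F p v)
                    + (p == v)%:R * (exchange M u v * F p u))); last first.
  by rewrite big_split /= !sum_delta.
apply: eq_bigr => p _.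
transitivity (\sum_q ((q == v)%:R * ((p == u)%:R * (straight M u v * F p q))
                    + (q == u)%:R * ((p == v)%:R * (exchange M u v * F p q)))).
  by apply: eq_bigr => q _; rewrite vertexE //; ring.
by rewrite big_split /= !sum_delta.
Qed.

Lemma sum_vertex_second M u v u' (F : T -> R) : conserves M ->
  \sum_r M u v u' r * F r
  = straight M u v * (u' == u)%:R * F v + exchange M u v * (u' == v)%:R * F u.
Proof.
move=> consM.
transitivity (\sum_r ((r == v)%:R * (straight M u v * (u' == u)%:R * F r)
                    + (r == u)%:R * (exchange M u v * (u' == v)%:R * F r))).
  by apply: eq_bigr => r _; rewrite vertexE //; ring.
by rewrite big_split /= !sum_delta.
Qed.

Lemma sum_vertex_first M u v v' (F : T -> R) : conserves M ->
  \sum_p M u v p v' * F p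
  = straight M u v * (v' == v)%:R * F u + exchange M u v * (v' == u)%:R * F v.
Proof.
move=> consM.
transitivity (\sum_p ((p == u)%:R * (straight M u v * (v' == v)%:R * F p)
                    + (p == v)%:R * (exchange M u v * (v' == u)%:R * F p))).
  by apply: eq_bigr => p _; rewrite vertexE //; ring.
by rewrite big_split /= !sum_delta.
Qed.

Definition yang_baxter M N K := forall u v w u' v' w',
  \sum_p \sum_q \sum_r M u v p q * N p w u' r * K q r v' w'
  = \sum_q \sum_r \sum_p K v w q r * N u r p w' * M p q u' v'.

(** Follow the spins u, v, w through the three crossings: after each crossing
    either they have kept their lines or the two spins that met have been
    exchanged, and the last of the three arrangements is the outgoing one.
    The values of [D] are placeholders for the six arrangements.  They are
    left as arbitrary values rather than split into six equations because
    arrangements coincide when two of u, v, w are equal, and then only the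
    sums of their coefficients agree. *)
Lemma yang_baxter_of_strands M N K :
  conserves M -> conserves N -> conserves K ->
  (forall (D : T -> T -> T -> R) u v w,
    straight M u v *
      (straight N u w * (straight K v w * D u v w + exchange K v w * D u w v)
     + exchange N u w * (straight K v u * D w v u + exchange K v u * D w u v))
  + exchange M u v *
      (straight N v w * (straight K u w * D v u w + exchange K u w * D v w u)
     + exchange N v w * (straight K u v * D w u v + exchange K u v * D w v u))
  = straight K v w *
      (straight N u w * (straight M u v * D u v w + exchange M u v * D v u w)
     + exchange N u w * (straight M w v * D w v u + exchange M w v * D v w u))
  + exchange K v w *
      (straight N u v * (straight M u w * D u w v + exchange M u w * D w u v)
     + exchange N u v * (straight M v w * D v w u + exchange M v w * D w v u)))
  -> yang_baxter M N K.
Proof.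
move=> consM consN consK strands u v w u' v' w'.
transitivity (\sum_p \sum_q M u v p q * (\sum_r N p w u' r * K q r v' w')).
  apply: eq_bigr => p _; apply: eq_bigr => q _.
  by rewrite mulr_sumr; apply: eq_bigr => r _; rewrite mulrA.
transitivity (\sum_q \sum_r K v w q r * (\sum_p N u r p w' * M p q u' v'));
  last first.
  apply: eq_bigr => q _; apply: eq_bigr => r _.
  by rewrite mulr_sumr; apply: eq_bigr => p _; rewrite mulrA.
rewrite !sum_vertex // !sum_vertex_second // !sum_vertex_first //.
rewrite !(vertexE _ _ v' w') // !(vertexE _ _ u' v') //.
(* The placeholder of an arrangement is the indicator that it is the outgoing
   one. *)
pose D x y z : R := (u' == x)%:R * (v' == y)%:R * (w' == z)%:R.
by apply: (etrans (etrans _ (strands D u v w))); rewrite /D; ring.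
Qed.

End ThreeLines.

(** * The Gamma and Delta weights as three-line models *)

Section IceModels.

Variables (d : Order.disp_t) (C : finOrderType d) (R : comNzRingType).
Implicit Types zi zj : R.

(** Goes down the rows of a weight table: each row's equalities between spins
    contradict the hypothesis that the outgoing pair is not a permutation of
    the incoming one. *)
Ltac conservation :=
  move=> [u|] [v|] [u'|] [v'|] //=; rewrite ?(inj_eq Some_inj);
  repeat (case: ifP => [/and3P[/eqP ? /eqP ?]|_];
    first by try (move=> /eqP ?); subst; rewrite !eqxx ?orbT);
  try done; by case: ifP => // /eqP ->; rewrite !eqxx ?orbT.

Ltac order_contradiction :=
  match goal with
  | H : is_true (?x < ?x)%O |- _ => by move: H; rewrite ltxx
  | H : is_true (?x < ?y)%O, H' : is_true (?y < ?x)%O |- _ =>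
      by move: (lt_trans H H'); rewrite ltxx
  | H : is_true (?x < ?y)%O, H' : is_true (?y < ?z)%O,
    H'' : is_true (?z < ?x)%O |- _ =>
      by move: (lt_trans (lt_trans H H') H''); rewrite ltxx
  end.

(** Once it is known which spins are 0 and how the colors compare, every weight
    is a polynomial in the parameters. *)
Ltac compare_strands :=
  rewrite /straight /exchange => D [u|] [v|] [w|] /=;
  rewrite ?(inj_eq Some_inj) ?eqxx ?ltxx /=;
  repeat (match goal with
          | |- context [Order.lt ?x ?y] => case: (ltgtP x y) => ?
          end;
          subst; rewrite ?eqxx ?ltxx /=; try order_contradiction);
  ring.

(** Spins travel rightwards along the rows and downwards along the vertical
    line: A and B enter an R-matrix on the left at its bottom left and top left,
    and C is the vertical line. *)
Lemma yang_baxter_Gamma_Gamma zi zj :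
  yang_baxter (@R_Gamma_Gamma _ C R zi zj)
    (@L_Gamma _ C R zi) (@L_Gamma _ C R zj).
Proof.
apply: yang_baxter_of_strands; try by conservation.
by compare_strands.
Qed.

(** A Delta-vertex sends its left and bottom spins to its right and top edges,
    so the vertical line is travelled upwards.  When the R-matrix is on the
    left, this line meets the row of zj before that of zi, so the line A shared
    by the first two crossings is the one entering the R-matrix at its top
    left. *)
Lemma yang_baxter_Delta_Delta zi zj :
  yang_baxter (fun tl bl br tr => @R_Delta_Delta _ C R zi zj bl tl tr br)
    (fun l b r t => @L_Delta _ C R zj l t r b)
    (fun l b r t => @L_Delta _ C R zi l t r b).
Proof.
apply: yang_baxter_of_strands; try by conservation.
by compare_strands.
Qed.

(** The Gamma-vertices are read backwards, from their right and bottom edges to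
    their left and top ones, which makes their vertical line agree with that of
    the Delta-vertices.  The R-matrix then sends its two bottom spins to its
    two top edges.  The lines A, B and C are the row of zj, the vertical line
    and the row of zi. *)
Lemma yang_baxter_Delta_Gamma zi zj :
  yang_baxter (fun r b l t => @L_Gamma _ C R zj l t r b)
    (fun br bl tl tr => @R_Delta_Gamma _ C R zi zj bl tl tr br)
    (fun b l t r => @L_Delta _ C R zi l t r b).
Proof.
apply: yang_baxter_of_strands; try by conservation.
by compare_strands.
Qed.

End IceModels.

Theorem proposition3p3 (n : nat) (disp : Order.disp_t)
    (C : finOrderType disp) (cardC : #|C| = (2 * n)%N)
    (R : comNzRingType) (Phi Theta : ice)
    (hPT : [\/ (Phi, Theta) = (Gamma, Gamma),
               (Phi, Theta) = (Delta, Delta) |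
               (Phi, Theta) = (Delta, Gamma)])
    (a b c d e f : spin C) (zi zj : R) :
  \sum_(p : spin C) \sum_(q : spin C) \sum_(r : spin C)
     Rmat Phi Theta zi zj a b p q
     * Lmat Phi zi p c d r
     * Lmat Theta zj q r e f
  = \sum_(p : spin C) \sum_(q : spin C) \sum_(r : spin C)
     Lmat Theta zj b c p r
     * Lmat Phi zi a r q f
     * Rmat Phi Theta zi zj q p d e.
Proof.
case: hPT => -[-> ->] /=.
- rewrite (yang_baxter_Gamma_Gamma zi zj a b c d e f).
  by apply: eq_bigr => p _; exact: exchange_big.
- have ybe := yang_baxter_Delta_Delta zi zj b a f e d c.
  apply: (etrans (etrans _ ybe)).
    rewrite exchange_big; apply: eq_bigr => q _; apply: eq_bigr => p _.
    by apply: eq_bigr => r _; ring.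
  rewrite [RHS]rotate_sums; apply: eq_bigr => q _; apply: eq_bigr => r _.
  by apply: eq_bigr => p _; ring.
have ybe := yang_baxter_Delta_Gamma zi zj e f a b c d.
apply: (etrans (etrans _ ybe)).
  rewrite rotate_sums; apply: eq_bigr => q _; apply: eq_bigr => r _.
  by apply: eq_bigr => p _; ring.
rewrite [RHS]rotate_sums [RHS]exchange_big.
apply: eq_bigr => r _; apply: eq_bigr => q _.
by apply: eq_bigr => p _; ring.
Qed.
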